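(* Let $k$ be a perfect field of characteristic $p>0$, $S=k[[x_1,\ldots,x_n]]$, $q=p^e$ with $e\geq 1$, $I\subsetneq S$ a square-free monomial ideal, and $R=S/I$. Let $\phi:R^{1/q}\to R$ be the $R$-linear map given by $z=(\prod_{i=1}^n x_i)^{q-1}$, that is, $\phi=\Phi/I$ with $\Phi(s)=\Phi_S\big((\prod_{i=1}^n x_i)^{(q-1)/q}s\big)$ for all $s\in S^{1/q}$, where $\Phi_S$ is the trace map. Let $\Delta$ be the simplicial complex associated to $I$ and let $f_{max}(\Delta)$ be the number of facets of $\Delta$. Then the test ideal $\tau(R,\phi)$ associated to the pair $(R,\phi)$ is $f_{max}(\Delta)$-generated. Therefore, for every ideal $\mathfrak a$ of $R$, every element $x\in\mathfrak a^*$ satisfies an equation of integral dependence of degree $f_{max}(\Delta)$ over $\mathfrak a$.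
   Context: $S^{1/q}$ is the ring of $q$-th roots of elements of $S$; it is a free $S$-module with basis $\{x_1^{\lambda_1/q}\cdots x_n^{\lambda_n/q}\}_{0\le\lambda_i\le q-1}$. The trace map $\Phi_S:S^{1/q}\to S$ is the $S$-linear map sending $x_1^{(q-1)/q}\cdots x_n^{(q-1)/q}$ to $1$ and all the other basis elements to $0$. $R$ is reduced and $R^{1/q}=S^{1/q}/I^{1/q}$ is its ring of $q$-th roots; for an ideal $J$, $J^{1/q}$ is the set of $q$-th roots of elements of $J$. The notation $\phi=\Phi/I$ means that $\Phi(I^{1/q})\subseteq I$ and $\phi$ is the induced map $S^{1/q}/I^{1/q}\to S/I$. $R^o$ is the complement of the union of the minimal primes of $R$. An ideal $J$ of $R$ is $\phi$-compatible if $\phi(J^{1/q})\subseteq J$. The test ideal $\tau(R,\phi)$ is the unique smallest (with respect to inclusion) $\phi$-compatible ideal $J$ of $R$ with $J\cap R^o\neq\emptyset$. An ideal is $m$-generated if it can be generated by $m$ elements. For $F\subseteq[n]=\{1,\dots,n\}$ put $x_F=\prod_{i\in F}x_i$. The simplicial complex $\Delta$ on $[n]$ associated to $I$ is the one whose faces are the $F\subseteq[n]$ with $x_F\notin I$. Facets are faces maximal under inclusion. The tight closure of an ideal $\mathfrak a$ of $R$ is $\mathfrak a^*=\{x\in R:\ \text{there exists } c\in R^o\text{ with } cx^{q'}\in\mathfrak a^{[q']}\text{ for all } q'=p^{e'}\gg0\}$, where $\mathfrak a^{[q']}$ is generated by the $q'$-th powers of elements of $\mathfrak a$. An element $x$ satisfies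 a degree $m$ equation of integral dependence over $\mathfrak a$ if $x^m+a_1x^{m-1}+\cdots+a_m=0$ for some $a_i\in\mathfrak a^i$. *)

(* Defs.v *)
From HB Require Import structures.
From mathcomp Require Import all_boot all_order all_algebra.
From mathcomp Require Import generic_quotient ring_quotient.
From mathcomp Require Import boolp classical_sets.
From mathcomp Require Import mpoly.

Set Implicit Arguments.
Unset Strict Implicit.
Unset Printing Implicit Defensive.

Import GRing.Theory.

Local Open Scope ring_scope.
Local Open Scope quotient_scope.
Local Open Scope classical_set_scope.

Record mpseries (n : nat) (k : nzRingType) : Type :=
  MPSeries { mpscoef :> 'X_{1..n} -> k }.

HB.instance Definition _ n k := gen_eqMixin (mpseries n k).
HB.instance Definition _ n k := gen_choiceMixin (mpseries n k).

Lemma mpseriesP n (k : nzRingType) (f g : mpseries n k) :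
  (forall m, f m = g m) -> f = g.
Proof. by case: f g => [f] [g] /= /funext ->. Qed.

Section MPSeriesRing.
Variables (n : nat) (k : comNzRingType).
Implicit Types f g h : mpseries n k.

Definition mps_const (c : k) : mpseries n k :=
  MPSeries (fun m => if m == 0%MM then c else 0).
Definition mps_add f g : mpseries n k := MPSeries (fun m => f m + g m).
Definition mps_opp f : mpseries n k := MPSeries (fun m => - f m).
Definition mps_mul f g : mpseries n k :=
  MPSeries (fun m =>
    \sum_(u : 'X_{1..n < (mdeg m).+1, (mdeg m).+1} | m == (u.1 + u.2)%MM)
      f u.1 * g u.2).

Fact mps_addA : associative mps_add.
Proof. by move=> f g h; apply: mpseriesP => m /=; rewrite addrA. Qed.
Fact mps_addC : commutative mps_add.
Proof. by move=> f g; apply: mpseriesP => m /=; rewrite addrC. Qed.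
Fact mps_add0 : left_id (mps_const 0) mps_add.
Proof. by move=> f; apply: mpseriesP => m /=; rewrite if_same add0r. Qed.
Fact mps_addN : left_inverse (mps_const 0) mps_opp mps_add.
Proof. by move=> f; apply: mpseriesP => m /=; rewrite if_same addNr. Qed.

HB.instance Definition _ :=
  GRing.isZmodule.Build (mpseries n k) mps_addA mps_addC mps_add0 mps_addN.

Definition mps_trunc d f : {mpoly k[n]} :=
  \sum_(m : 'X_{1..n < d}) f m *: 'X_[m].

Lemma mps_truncE d f m : (mdeg m < d)%N -> (mps_trunc d f)@_m = f m.
Proof. exact: mcoeff_mpoly. Qed.

Lemma mps_mulE d f g m : (mdeg m < d)%N ->
  mps_mul f g m = (mps_trunc d f * mps_trunc d g)@_m.
Proof.
move=> md; rewrite (mcoeff_poly_mul _ _ (k := (mdeg m).+1)) //=.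
apply: eq_bigr => u _; rewrite !mps_truncE //.
- exact: leq_trans (bmdeg _) md.
- exact: leq_trans (bmdeg _) md.
Qed.

Lemma mcoeffM_eq (d : nat) (p p' r r' : {mpoly k[n]}) :
    (forall m, (mdeg m < d)%N -> p@_m = p'@_m) ->
    (forall m, (mdeg m < d)%N -> r@_m = r'@_m) ->
  forall m, (mdeg m < d)%N -> (p * r)@_m = (p' * r')@_m.
Proof.
move=> Ep Er m md; rewrite !(mcoeff_poly_mul _ _ (k := (mdeg m).+1)) //.
apply: eq_bigr => u _; rewrite Ep ?Er //.
- exact: leq_trans (bmdeg _) md.
- exact: leq_trans (bmdeg _) md.
Qed.

Lemma mps_trunc_mul d f g m : (mdeg m < d)%N ->
  (mps_trunc d (mps_mul f g))@_m = (mps_trunc d f * mps_trunc d g)@_m.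
Proof. by move=> md; rewrite mps_truncE // (mps_mulE _ _ md). Qed.

Fact mps_mulA : associative mps_mul.
Proof.
move=> f g h; apply: mpseriesP => m; have md := ltnSn (mdeg m).
rewrite !(mps_mulE _ _ md).
rewrite (mcoeffM_eq (fun _ _ => erefl) (@mps_trunc_mul _ g h) md) mulrA.
by rewrite (mcoeffM_eq (@mps_trunc_mul _ f g) (fun _ _ => erefl) md).
Qed.

Fact mps_mulC : commutative mps_mul.
Proof.
move=> f g; apply: mpseriesP => m; have md := ltnSn (mdeg m).
by rewrite !(mps_mulE _ _ md) mulrC.
Qed.

Fact mps_mul1 : left_id (mps_const 1) mps_mul.
Proof.
move=> f; apply: mpseriesP => m; have md := ltnSn (mdeg m).
rewrite (mps_mulE _ _ md) -[RHS](mps_truncE f md) -[in RHS](mul1r (mps_trunc _ f)).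
apply: (mcoeffM_eq _ (fun _ _ => erefl) md) => u ud.
by rewrite mps_truncE // mcoeff1 /=; case: eqP.
Qed.

Fact mps_mulDl : left_distributive mps_mul mps_add.
Proof.
move=> f g h; apply: mpseriesP => m; rewrite /= -big_split /=.
by apply: eq_bigr => u _; rewrite mulrDl.
Qed.

Fact mps_1_neq0 : mps_const 1 != mps_const 0.
Proof.
apply/eqP => /(congr1 (fun f : mpseries n k => f 0%MM)) /=.
by rewrite eqxx => /eqP; rewrite oner_eq0.
Qed.

HB.instance Definition _ := GRing.Zmodule_isComNzRing.Build (mpseries n k)
  mps_mulA mps_mulC mps_mul1 mps_mulDl mps_1_neq0.

Definition mps_var (i : 'I_n) : mpseries n k :=
  MPSeries (fun m => (m == U_(i)%MM)%:R).

Definition mps_xset (F : {set 'I_n}) : mpseries n k := \prod_(i in F) mps_var i.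

End MPSeriesRing.

Section Ideals.
Variable A : comNzRingType.
Implicit Types (J P : set A) (x : A).

(* Unlike [idealr], this allows the unit ideal. *)
Definition is_ideal J : Prop :=
  [/\ J 0, forall x y, J x -> J y -> J (x + y) & forall a x, J x -> J (a * x)].

Definition ideal_gen (X : set A) : set A := smallest is_ideal X.

Definition generated_by_n (m : nat) J : Prop :=
  exists g : 'I_m -> A, J = ideal_gen (range g).

Definition ideal_pow J (i : nat) : set A :=
  ideal_gen [set y | exists2 f : 'I_i -> A,
                       (forall j, J (f j)) & y = \prod_(j < i) f j].

Definition frobenius_pow J (r : nat) : set A :=
  ideal_gen [set y ^+ r | y in J].

Definition is_prime_ideal P : Prop :=
  [/\ is_ideal P, ~ P 1 & forall a b, P (a * b) -> P a \/ P b].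

Definition is_minimal_prime P : Prop :=
  is_prime_ideal P /\ forall P', is_prime_ideal P' -> P' `<=` P -> P' = P.

Definition not_in_minimal_primes : set A :=
  ~` (\bigcup_(P in [set P | is_minimal_prime P]) P).

Definition tight_closure (p : nat) J : set A :=
  [set x | exists2 c, not_in_minimal_primes c &
     exists N : nat, forall e', (N <= e')%N ->
       frobenius_pow J (p ^ e')%N (c * x ^+ (p ^ e')%N)].

Definition integral_equation (m : nat) J x : Prop :=
  exists2 a : nat -> A, (forall i, (1 <= i <= m)%N -> ideal_pow J i (a i)) &
    x ^+ m + \sum_(1 <= i < m.+1) a i * x ^+ (m - i) = 0.

End Ideals.

Arguments not_in_minimal_primes : clear implicits.

(* For [A] reduced of characteristic [p] and [q] a power of [p], the map
   [a |-> a^{1/q}] is a ring isomorphism from [A] onto the ring [A^{1/q}] of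
   [q]-th roots.  So [A^{1/q}] is encoded as a copy of [A], in which
   [qroot q a] stands for [a^{1/q}] (and [qpow] is its inverse [t |-> t ^ q]);
   the inclusion of [A] in [A^{1/q}] is then the map [qincl] sending [a] to
   [(a ^ q)^{1/q}].  See [qincl_monoid_morphism], [qinclB],
   [qincl_inj], [qroot_expE] and [qpowE]. *)
Definition qroots (q : nat) (A : comNzRingType) : Type := A.

HB.instance Definition _ (q : nat) (A : comNzRingType) :=
  GRing.ComNzRing.on (qroots q A).

Section QRoots.
Variables (q : nat) (A : comNzRingType).

Definition qroot (a : A) : qroots q A := a.
Definition qpow (t : qroots q A) : A := t.
Definition qincl (a : A) : qroots q A := qroot (a ^+ q).

Lemma qroot_expE (a : A) : qroot a ^+ q = qincl a.
Proof. by []. Qed.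

Lemma qpowE (t : qroots q A) : qincl (qpow t) = t ^+ q.
Proof. by []. Qed.

Lemma qincl_monoid_morphism : monoid_morphism qincl.
Proof.
split; first exact: (expr1n A q).
by move=> a b; rewrite /qincl exprMn.
Qed.

Lemma qinclB (p e : nat) : p \in [pchar A] -> q = (p ^ e)%N ->
  {morph qincl : a b / a - b}.
Proof.
move=> pA qE a b; rewrite -[LHS]/((a - b) ^+ q) -[RHS]/(a ^+ q - b ^+ q) qE.
elim: e {qE} => [|e IHe]; first by rewrite expn0 !expr1.
rewrite expnSr !exprM IHe -!(pFrobenius_autE pA).
exact: pFrobenius_autB_comm (mulrC _ _).
Qed.

Lemma qincl_inj (p e : nat) :
    p \in [pchar A] -> q = (p ^ e)%N ->
    (forall (a : A) r, a ^+ r = 0 -> a = 0) ->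
  injective qincl.
Proof.
move=> pA qE redA a b ab; apply/eqP; rewrite -subr_eq0; apply/eqP.
apply: (redA _ q); change (qincl (a - b) = 0).
by rewrite (qinclB pA qE) ab subrr.
Qed.

Definition qideal (J : set A) : set (qroots q A) := [set qroot a | a in J].

Definition qlinear (Phi : qroots q A -> A) : Prop :=
  forall (a : A) (t u : qroots q A), Phi (qincl a * t + u) = a * Phi t + Phi u.

Definition phi_compatible (phi : qroots q A -> A) (J : set A) : Prop :=
  phi @` qideal J `<=` J.

Definition is_test_ideal (phi : qroots q A -> A) (tau : set A) : Prop :=
  let candidate J := [/\ is_ideal J, phi_compatible phi J &
                         J `&` not_in_minimal_primes A !=set0] in
  candidate tau /\ forall J, candidate J -> tau `<=` J.

End QRoots.

Definition perfect_of_char (p : nat) (k : fieldType) : Prop :=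
  p \in [pchar k] /\ forall a : k, exists b : k, b ^+ p = a.

Section MonomialIdeals.
Variables (n : nat) (k : fieldType) (q : nat).
Local Notation S := (mpseries n k).

Definition qmonomial (lambda : {ffun 'I_n -> 'I_q}) : qroots q S :=
  \prod_(i < n) qroot q (mps_var k i) ^+ lambda i.

Definition is_trace_map (Phi : qroots q S -> S) : Prop :=
  qlinear Phi /\
  forall lambda : {ffun 'I_n -> 'I_q},
    Phi (qmonomial lambda) =
      if [forall i, lambda i == q.-1 :> nat] then 1 else 0.

Variable I : idealr S.
Local Notation R := {ideal_quot I}.

Definition is_squarefree_monomial_ideal : Prop :=
  exists G : {set {set 'I_n}},
    [set` I] = ideal_gen [set mps_xset k F | F in [set` G]].

Definition stanley_reisner_complex : {set {set 'I_n}} :=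
  [set F : {set 'I_n} | mps_xset k F \notin I]%SET.

Definition facets : {set {set 'I_n}} :=
  [set F : {set 'I_n} | maxset (mem stanley_reisner_complex) F]%SET.

Definition f_max : nat := #|facets|.

Definition qproj (t : qroots q S) : qroots q R := qroot q (\pi_R (qpow t)).

(* The relation written [phi = Phi / I]. *)
Definition is_induced_map (Phi : qroots q S -> S) (phi : qroots q R -> R) :
    Prop :=
  Phi @` qideal [set` I] `<=` [set` I] /\
  forall s : qroots q S, phi (qproj s) = \pi_R (Phi s).

End MonomialIdeals.

(* Main.v *)
Require Import Defs.
From HB Require Import structures.
From mathcomp Require Import all_boot all_order all_algebra.
From mathcomp Require Import generic_quotient ring_quotient.
From mathcomp Require Import boolp classical_sets.
From mathcomp Require Import mpoly.

Set Implicit Arguments.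
Unset Strict Implicit.
Unset Printing Implicit Defensive.

Import Order.TTheory GRing.Theory.
Local Open Scope ring_scope.

(** Let [Phi] be multiplication by the [q - 1]-th power of the product of the
    variables, followed by the trace map.  On coefficients [Phi] is the map [f |-> (m |-> (f (q m))^(1/q))]: it keeps the
    monomials whose exponents are divisible by [q] and extracts their [q]-th
    roots.  This holds because, [k] being perfect, every [f] is a combination
    of the basis monomials with coefficients that are [q]-th powers
    ([mps_frobenius_basis]), and only the monomial of exponents [q - 1]
    survives the trace ([mpscoef_trace], [mpscoef_toric_trace]).

    For a face [F] let [P_F] be the prime generated by the variables outside
    [F], that is, the series without monomials supported in [F].  The ideal
    [I] is the intersection of the [P_F] over the facets, and the images of
    these [P_F] are the minimal primes of [R]
    ([squarefree_monomial_ideal_facets], [minimal_prime_facetP]).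

    The test ideal is generated by the monomials [x_F], [F] a facet.  Two facts
    about the iterates of [Phi] give this.
    - They map multiples of [x_F] to multiples of [x_F], because an exponent
      [m] has the same support as [q m] ([iter_toric_xset]).  So the ideal of
      the [x_F] is compatible with [phi].
    - If [c] is not in [P_F], then for all large [E] some multiple of [x_F c]
      is mapped to [x_F] by the [E]-th iterate ([toric_recovers_xset]).
      Multiplication by a monomial moves a monomial [x^m] of [c] supported in
      [F] to [x_F^(q^E)]; the image is then [x_F] times a series with nonzero
      constant term, which is a unit.  So a compatible ideal that meets the
      complement of the minimal primes contains every [x_F].

    The second fact also controls tight closure.  Let [x] be in [a^*] with
    multiplier [c], and choose [d] with [x_F = phi^E (x_F d c)].  Then
    [x x_F = phi^E (x_F d c x^(q^E))], and [c x^(q^E)] lies in [a^[q^E]], so that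
    [x x_F] lies in [a phi^E (x_F R)], which is contained in [x_F a].  Hence
    [x_F (x - b_F) = 0] for some [b_F] in [a], and so [x - b_F] is in the
    minimal prime of [F].  The product of the [x - b_F] over all facets is in
    every minimal prime, so it is [0]; its expansion is the equation of
    integral dependence. *)

(** * Coefficients, monomials and units of power series *)

Definition mps_monom n (k : nzRingType) (u : 'X_{1..n}) : mpseries n k :=
  MPSeries (fun m => (m == u)%:R).

Section PowerSeries.
Variables (n : nat) (k : comNzRingType).
Local Notation S := (mpseries n k).
Implicit Types (f g : S) (u m : 'X_{1..n}).

Lemma mpscoefM f g m :
  (f * g) m = \sum_(v : 'X_{1..n < (mdeg m).+1, (mdeg m).+1} |
                     m == (v.1 + v.2)%MM) f v.1 * g v.2.
Proof. by []. Qed.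

Lemma mpscoef_sum (T : Type) (r : seq T) (P : pred T) (F : T -> S) m :
  (\sum_(i <- r | P i) F i) m = \sum_(i <- r | P i) F i m.
Proof.
elim/big_rec2: _ => [|i y1 y2 _ <- //].
by rewrite -[LHS]/(if _ then _ else _) if_same.
Qed.

Lemma mpscoef1 m : (1 : S) m = (m == 0%MM)%:R.
Proof. by rewrite -[LHS]/(if _ then _ else _); case: eqP. Qed.

(** Lets a coefficient of a product be read off whenever only one way of
    splitting the exponent contributes to the convolution. *)
Lemma mpscoef_unique_factor f g m u v :
  m = (u + v)%MM ->
  (forall u' v', m = (u' + v')%MM -> u' != u -> f u' * g v' = 0) ->
  (f * g) m = f u * g v.
Proof.
move=> mE uniq.
have hu : (mdeg u < (mdeg m).+1)%N by rewrite mE mdegD ltnS leq_addr.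
have hv : (mdeg v < (mdeg m).+1)%N by rewrite mE mdegD ltnS leq_addl.
rewrite mpscoefM (bigD1 (BMultinom hu, BMultinom hv)) /=; last by rewrite mE.
rewrite big1 ?addr0 // => -[[u' hu'] [v' hv']] /= /andP[/eqP mE' ne].
apply: uniq => //; apply: contraNneq ne => uE; apply/eqP; congr pair;
  apply: val_inj => //=.
by apply: (@addmI _ u); rewrite -mE mE' uE.
Qed.

Lemma mpscoef_monomM u f m :
  (mps_monom k u * f) m = if (u <= m)%MM then f (m - u)%MM else 0.
Proof.
case: ifP => [um|num].
  rewrite (@mpscoef_unique_factor _ _ m u (m - u)%MM) /= ?eqxx ?mul1r //.
    by rewrite addmC submK.
  by move=> u' v' _ /negbTE ->; rewrite mul0r.
rewrite mpscoefM big1 // => -[u' v'] /= /eqP mE.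
case: eqP => [uE|_]; last by rewrite mul0r.
by have := lem_addr u' v'; rewrite -mE uE num.
Qed.

Lemma mps_monomD u m : mps_monom k (u + m)%MM = mps_monom k u * mps_monom k m.
Proof.
apply: mpseriesP => v; rewrite mpscoef_monomM /=.
case: ifP => [uv|nuv]; last first.
  by case: eqP => // vE; move: nuv; rewrite vE lem_addr.
by rewrite -(inj_eq (@addmI _ u) (v - u)%MM) [(u + (v - u))%MM]addmC submK.
Qed.

Lemma mps_monom0 : mps_monom k (0%MM : 'X_{1..n}) = 1.
Proof. by apply: mpseriesP => m; rewrite mpscoef1. Qed.

Lemma mps_monom_sum (T : Type) (r : seq T) (P : pred T) (F : T -> 'X_{1..n}) :
  mps_monom k (\sum_(i <- r | P i) F i)%MM
  = \prod_(i <- r | P i) mps_monom k (F i).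
Proof. exact: (big_morph _ mps_monomD mps_monom0). Qed.

Lemma mps_monomMn u i : mps_monom k (u *+ i)%MM = mps_monom k u ^+ i.
Proof.
by elim: i => [|i IHi]; rewrite ?mulm0n ?mps_monom0 // mulmS mps_monomD IHi exprS.
Qed.

Lemma mps_varE i : mps_var k i = mps_monom k (U_(i)%MM : 'X_{1..n}).
Proof. by []. Qed.

Definition mnm_set (F : {set 'I_n}) : 'X_{1..n} :=
  [multinom (i \in F : nat) | i < n].

Lemma mps_prod_varE (a : 'I_n -> nat) :
  \prod_(i < n) mps_var k i ^+ a i = mps_monom k [multinom a i | i < n].
Proof.
under eq_bigr => i _ do rewrite mps_varE -mps_monomMn.
rewrite -mps_monom_sum; congr mps_monom.
by rewrite [RHS]multinomUE_id; apply: eq_bigr => i _; rewrite mnmE.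
Qed.

Lemma mps_xsetE (F : {set 'I_n}) : mps_xset k F = mps_monom k (mnm_set F).
Proof.
rewrite -mps_prod_varE /mps_xset big_mkcond /=; apply: eq_bigr => i _.
by case: (i \in F).
Qed.

Lemma mpscoefM_eq d f f' g g' :
    (forall m, (mdeg m < d)%N -> f m = f' m) ->
    (forall m, (mdeg m < d)%N -> g m = g' m) ->
  forall m, (mdeg m < d)%N -> (f * g) m = (f' * g') m.
Proof.
move=> Ef Eg m md; rewrite !mpscoefM; apply: eq_bigr => u _.
rewrite Ef ?Eg //; exact: leq_trans (bmdeg _) md.
Qed.

Lemma mpscoefX_small f j m :
  f 0%MM = 0 -> (mdeg m < j)%N -> (f ^+ j) m = 0.
Proof.
move=> f0; elim: j m => // j IHj m mj; rewrite exprS mpscoefM big1 //.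
move=> -[u v] /= /eqP mE.
have [->|u0] := eqVneq (u : 'X_{1..n}) 0%MM; first by rewrite f0 mul0r.
rewrite IHj ?mulr0 // -ltnS; apply: leq_ltn_trans mj.
rewrite [X in (_ < mdeg X)%N]mE mdegD -[X in (X < _)%N]add0n ltn_add2r.
by rewrite lt0n mdeg_eq0.
Qed.

(** The inverse is the geometric series in [1 - f]: its coefficient at [m] only
    depends on the powers up to [mdeg m], so it is defined by finite sums. *)
Lemma mps_inverse_of_coef0 f : f 0%MM = 1 -> exists g : S, f * g = 1.
Proof.
move=> f0; pose h := 1 - f.
have h0 : h 0%MM = 0.
  by rewrite -[LHS]/(((1 : S) 0%MM) - f 0%MM) f0 mpscoef1 eqxx subrr.
pose G d : S := \sum_(i < d) h ^+ i.
exists (MPSeries (fun m => G (mdeg m).+1 m)); apply: mpseriesP => m.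
have GE d u : (mdeg u < d)%N -> G d u = G (mdeg u).+1 u.
  move=> ud; rewrite /G !mpscoef_sum.
  rewrite -!(big_mkord xpredT (fun i => (h ^+ i) u)).
  rewrite (big_cat_nat _ (n := (mdeg u).+1)) //= [X in _ + X]big_nat.
  rewrite [X in _ + X]big1 ?addr0 //.
  by move=> i /andP[ui _]; apply: mpscoefX_small.
pose d := (mdeg m).+1.
rewrite (@mpscoefM_eq d f f _ (G d)) //; last by move=> u ud /=; rewrite GE.
have -> : f * G d = 1 - h ^+ d.
  rewrite -{1}[1](expr1n _ d) subrXX subKr; congr (_ * _).
  by apply: eq_bigr => i _; rewrite expr1n mul1r.
by rewrite -[LHS]/((1 : S) m - (h ^+ d) m) mpscoefX_small ?subr0.
Qed.

End PowerSeries.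

Lemma mps_unit n (k : fieldType) (f : mpseries n k) :
  f 0%MM != 0 -> exists g, f * g = 1.
Proof.
move=> f0.
have mcE c (h : mpseries n k) m : (mps_const n c * h) m = c * h m.
  rewrite (@mpscoef_unique_factor _ _ _ _ m 0%MM m) ?add0m ?eqxx //= ?eqxx //.
  move=> u' v' _ /negbTE ->.
  by rewrite mul0r.
have [g gE] : exists g, (mps_const n (f 0%MM)^-1 * f) * g = 1.
  by apply: mps_inverse_of_coef0; rewrite mcE mulVf.
by exists (mps_const n (f 0%MM)^-1 * g); rewrite mulrCA mulrA.
Qed.

Section QLinear.
Variables (A : comNzRingType) (q : nat) (Phi : qroots q A -> A).
Hypothesis lin : qlinear Phi.

Lemma qlinear0 : Phi 0 = 0.
Proof.
have /(congr1 (fun z => z - Phi 0)) := lin 1 0 0.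
by rewrite mulr0 addr0 mul1r subrr addrK.
Qed.

Lemma qlinearD t u : Phi (t + u) = Phi t + Phi u.
Proof. by have := lin 1 t u; rewrite /qincl /qroot expr1n !mul1r. Qed.

Lemma qlinearM (a t : A) : Phi (a ^+ q * t) = a * Phi t.
Proof. by have := lin a t 0; rewrite qlinear0 !addr0. Qed.

Lemma qlinear_sum (T : Type) (r : seq T) (P : pred T) (a t : T -> A) :
  Phi (\sum_(i <- r | P i) a i ^+ q * t i) = \sum_(i <- r | P i) a i * Phi (t i).
Proof.
elim/big_rec2: _ => [|i x y _ <-]; first exact: qlinear0.
exact: lin.
Qed.

Lemma iter_qlinear0 E : iter E (Phi : A -> A) 0 = 0.
Proof. by elim: E => // E IHE; rewrite iterS IHE qlinear0. Qed.

Lemma iter_qlinearD E (t u : A) :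
  iter E (Phi : A -> A) (t + u) = iter E (Phi : A -> A) t + iter E (Phi : A -> A) u.
Proof. by elim: E => // E IHE; rewrite !iterS IHE qlinearD. Qed.

Lemma iter_qlinearM E (a t : A) :
  iter E (Phi : A -> A) (a ^+ (q ^ E) * t) = a * iter E (Phi : A -> A) t.
Proof.
elim: E a => [|E IHE] a; first by rewrite expn0 expr1.
by rewrite !iterS expnS exprM IHE qlinearM.
Qed.

End QLinear.

(** * The Frobenius map and the trace map *)

Lemma perfect_qroot (k : fieldType) p e :
  perfect_of_char p k -> forall a : k, exists b : k, b ^+ (p ^ e) = a.
Proof.
move=> [_ root_p]; elim: e => [|e IHe] a; first by exists a; rewrite expn0 expr1.
have [b bE] := root_p a; have [c cE] := IHe b.
by exists c; rewrite expnSr exprM cE.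
Qed.

Section Frobenius.
Variables (n : nat) (k : fieldType) (p e q : nat).
Hypotheses (kp : perfect_of_char p k) (qE : q = (p ^ e)%N).
Local Notation S := (mpseries n k).
Implicit Types (f g : S) (u m : 'X_{1..n}).

Let q_gt0 : (0 < q)%N.
Proof. by rewrite qE expn_gt0 prime_gt0 // (pcharf_prime kp.1). Qed.

Lemma mps_trunc_exp f d j m : (mdeg m < d)%N ->
  (f ^+ j) m = (mps_trunc d f ^+ j)@_m.
Proof.
elim: j m => [|j IHj] m md; first by rewrite !expr0 mpscoef1 mcoeff1.
rewrite !exprS -[LHS]/(mps_mul f (f ^+ j) m) (mps_mulE _ _ md).
by apply: (@mcoeffM_eq _ _ d) md => // u ud; rewrite mps_truncE // IHj.
Qed.

(** Only finitely many coefficients of [f] matter at [m]; on the polynomial that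
    they form, raising to the power [q] is additive in characteristic [p]. *)
Lemma mpscoef_frobenius f m :
  (f ^+ q) m = \sum_(u : 'X_{1..n < (mdeg m).+1} | (u *+ q)%MM == m) f u ^+ q.
Proof.
have polyp : p \in [pchar {mpoly k[n]}].
  by rewrite (rmorph_pchar (@mpolyC n k)) // kp.1.
have exprqD : {morph (fun P : {mpoly k[n]} => P ^+ q) : P Q / P + Q}.
  move=> P Q; rewrite exprDn_pchar // qE pnatX.
  by rewrite pnatE ?(pcharf_prime kp.1) // polyp.
have exprq0 : (0 : {mpoly k[n]}) ^+ q = 0 by rewrite expr0n gtn_eqF.
rewrite (@mps_trunc_exp _ (mdeg m).+1) // /mps_trunc (big_morph _ exprqD exprq0).
rewrite raddf_sum [RHS]big_mkcond /=; apply: eq_bigr => u _.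
by rewrite exprZn mcoeffZ mcoeffXn; case: ifP; rewrite ?mulr1 ?mulr0.
Qed.

Lemma mpscoef_frobenius_mul f m : (f ^+ q) (m *+ q)%MM = f m ^+ q.
Proof.
have md : (mdeg m < (mdeg (m *+ q)).+1)%N.
  by rewrite mdegMn ltnS leq_pmulr.
rewrite mpscoef_frobenius (bigD1 (BMultinom md)) //= big1 ?addr0 //.
move=> u /andP[/eqP uE].
case/eqP; apply: val_inj => /=; apply/mnmP => i; apply/eqP.
by rewrite -(eqn_pmul2r q_gt0) -!mulmnE uE.
Qed.

Lemma mpscoef_frobenius_ndvd f m i : ~~ (q %| m i)%N -> (f ^+ q) m = 0.
Proof.
move=> ndvd; rewrite mpscoef_frobenius big1 // => u /eqP uE.
by case/negP: ndvd; rewrite -uE mulmnE dvdn_mull.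
Qed.

Definition mnm_of_exp (lambda : {ffun 'I_n -> 'I_q}) : 'X_{1..n} :=
  [multinom (lambda i : nat) | i < n].

Lemma qmonomialE (lambda : {ffun 'I_n -> 'I_q}) :
  qmonomial k lambda = mps_monom k (mnm_of_exp lambda) :> S.
Proof. exact: mps_prod_varE. Qed.

(** Division with remainder by [q] of the exponents sorts the monomials of [f]
    by their class [lambda]; within a class the [q]-th roots [rt] of the
    coefficients make up one [q]-th power. *)
Lemma mps_frobenius_basis f (rt : k -> k) : (forall a, rt a ^+ q = a) ->
  f = \sum_(lambda : {ffun 'I_n -> 'I_q})
    MPSeries (fun m => rt (f (m *+ q + mnm_of_exp lambda)%MM)) ^+ q
      * mps_monom k (mnm_of_exp lambda).
Proof.
move=> rtE; apply: mpseriesP => m; rewrite mpscoef_sum.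
pose l0 : {ffun 'I_n -> 'I_q} := [ffun i => Ordinal (ltn_pmod (m i) q_gt0)].
rewrite (bigD1 l0) // big1 => [|l ll0]; rewrite mulrC mpscoef_monomM.
  pose m' : 'X_{1..n} := [multinom (m i %/ q)%N | i < n].
  have mE : m = (m' *+ q + mnm_of_exp l0)%MM.
    by apply/mnmP => i; rewrite mnmDE mulmnE !mnmE ffunE /= -divn_eq.
  have -> : (m - mnm_of_exp l0)%MM = (m' *+ q)%MM by rewrite [in LHS]mE addmK.
  by rewrite [in if _ then _ else _]mE lem_addl mpscoef_frobenius_mul /= rtE -mE addr0.
case: ifP => // /mnm_lepP lm.
have /existsP[i li] : [exists i, l i != l0 i].
  rewrite -negb_forall; apply: contra ll0 => /forallP H.
  by apply/eqP/ffunP => i; apply/eqP.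
apply: (@mpscoef_frobenius_ndvd _ _ i).
apply: contra li => dv; apply/eqP/val_inj; rewrite ffunE /=.
move: dv (lm i); rewrite mnmBE mnmE => dv lmi.
have := eqn_mod_dvd q lmi; rewrite dv => /eqP ->.
by rewrite modn_small.
Qed.

(** The trace picks the component of index [q - 1] in the decomposition of [f]
    along the basis monomials. *)
Lemma mpscoef_trace (Phi : qroots q S -> S) : is_trace_map Phi ->
  forall f m, Phi f m ^+ q = f (m *+ q + [multinom q.-1 | i < n])%MM.
Proof.
move=> [lin val] f m.
have rootq (a : k) : exists b : k, b ^+ q = a.
  by rewrite qE; apply: perfect_qroot.
pose rt a := sval (cid (rootq a)).
have rtE a : rt a ^+ q = a := svalP (cid (rootq a)).
rewrite {1}(mps_frobenius_basis f rtE) (qlinear_sum lin).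
under eq_bigr => l _ do rewrite -qmonomialE val.
have q1 : (q.-1 < q)%N by rewrite prednK.
pose l1 : {ffun 'I_n -> 'I_q} := [ffun=> Ordinal q1].
rewrite (bigD1 l1) // big1 => [|l ll1].
  rewrite Monoid.mulm1 ifT; last by apply/forallP => i; rewrite ffunE.
  rewrite mulr1 /= rtE; congr (f (_ + _)%MM); apply/mnmP => i.
  by rewrite !mnmE ffunE.
case: ifP => [/forallP H|_]; last by rewrite mulr0.
by case/eqP: ll1; apply/ffunP => i; apply/val_inj/eqP; rewrite ffunE H.
Qed.

Lemma qlinear_premul (Phi : qroots q S -> S) (z : S) : qlinear Phi ->
  qlinear (fun s => Phi (qroot q z * s)).
Proof. by move=> lin a t u; rewrite mulrDr mulrCA lin. Qed.

Lemma mpscoef_toric_trace (Phi : qroots q S -> S) : is_trace_map Phi ->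
  forall f m,
  Phi (qroot q ((\prod_(i < n) mps_var k i) ^+ (q - 1)) * f) m ^+ q
    = f (m *+ q)%MM.
Proof.
move=> trPhi f m; rewrite (mpscoef_trace trPhi).
have -> : (\prod_(i < n) mps_var k i) ^+ (q - 1)
          = mps_monom k [multinom q.-1 | i < n].
  rewrite (_ : \prod_(i < n) mps_var k i = \prod_(i < n) mps_var k i ^+ 1) //.
  rewrite mps_prod_varE -mps_monomMn; congr mps_monom; apply/mnmP => i.
  by rewrite mulmnE !mnmE mul1n subn1.
by rewrite -[LHS]/((mps_monom k _ * (f : S)) _) mpscoef_monomM lem_addl addmK.
Qed.
End Frobenius.

(** * Ideals given by predicates *)

Section Ideals.
Variable A : comNzRingType.
Implicit Types (J P X : set A) (x : A).
Local Open Scope classical_set_scope.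

Lemma is_ideal_gen X : is_ideal (ideal_gen X).
Proof.
split=> [J [[]] //|x y xX yX J JX|a x xX J JX]; have [[_ JD JM] _] := JX.
- by apply: JD; [apply: xX | apply: yX].
- by apply: JM; apply: xX.
Qed.

Lemma mem_ideal_gen X x : X x -> ideal_gen X x.
Proof. by move=> Xx J [_]; apply. Qed.

Lemma ideal_gen_sub X J : is_ideal J -> X `<=` J -> ideal_gen X `<=` J.
Proof. by move=> idJ XJ x; apply; split. Qed.

Lemma ideal_sum J (T : Type) (r : seq T) (P : pred T) (F : T -> A) :
  is_ideal J -> (forall i, P i -> J (F i)) -> J (\sum_(i <- r | P i) F i).
Proof. by move=> [J0 JD _] JF; apply: big_ind. Qed.

Lemma idealB J x y : is_ideal J -> J x -> J y -> J (x - y).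
Proof.
by move=> [_ JD JM] Jx Jy; rewrite -mulN1r; apply: JD => //; apply: JM.
Qed.

Lemma idealMl J a x : is_ideal J -> J x -> J (a * x).
Proof. by move=> [_ _]; apply. Qed.

Lemma prime_ideal_prod P (T : Type) (r : seq T) (Q : pred T) (F : T -> A) :
  is_prime_ideal P -> (forall i, Q i -> ~ P (F i)) ->
  ~ P (\prod_(i <- r | Q i) F i).
Proof.
by move=> [_ P1 PM] PF; apply: (big_ind (fun x => ~ P x)) => // x y Px Py /PM[].
Qed.

End Ideals.

(** * Face ideals and square-free monomial ideals *)

Section FaceIdeals.
Variables (n : nat) (k : fieldType).
Local Notation S := (mpseries n k).
Implicit Types (f g : S) (u m : 'X_{1..n}) (F G : {set 'I_n}).

Definition mnm_supp m : {set 'I_n} := [set i | m i != 0%N].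

(** The ideal generated by the variables outside [F], described by coefficients
    so that no generators have to be handled. *)
Definition face_ideal F : set S :=
  [set f | forall m, mnm_supp m \subset F -> f m = 0].

Lemma mnm_suppD u m : mnm_supp (u + m)%MM = mnm_supp u :|: mnm_supp m.
Proof. by apply/setP => i; rewrite !inE mnmDE addn_eq0 negb_and. Qed.

Lemma mnm_supp_set F : mnm_supp (mnm_set F) = F.
Proof. by apply/setP => i; rewrite !inE mnmE eqb0 negbK. Qed.

Lemma mnm_set_le F m : (mnm_set F <= m)%MM = (F \subset mnm_supp m).
Proof.
apply/mnm_lepP/fintype.subsetP => [Fm i iF|Fm i].
  by have := Fm i; rewrite mnmE iF inE lt0n.
by rewrite mnmE; case iF: (i \in F) => //; have := Fm i iF; rewrite inE lt0n.
Qed.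

Lemma mps_monom_dvdP u f :
  (forall m, f m != 0 -> (u <= m)%MM) ->
  f = mps_monom k u * MPSeries (fun m => f (u + m)%MM).
Proof.
move=> fu; apply: mpseriesP => m; rewrite mpscoef_monomM /=.
case: ifP => [um|num]; first by rewrite addmC submK.
by apply/eqP; apply: contraFT num => /fu.
Qed.

Lemma is_ideal_face F : is_ideal (face_ideal F).
Proof.
split=> [m _|f g ff gf m mF|f g gf m mF].
- by rewrite -[LHS]/(if _ then _ else _) if_same.
- by rewrite -[LHS]/(f m + g m) ff // gf // addr0.
rewrite mpscoefM big1 // => -[u v] /= /eqP mE.
rewrite gf ?mulr0 //; apply: fintype.subset_trans mF.
by rewrite [X in _ \subset mnm_supp X]mE mnm_suppD finset.subsetUr.
Qed.

(** A leading monomial modulo [face_ideal F]; it exists because the monomial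
    order is well founded. *)
Lemma face_ideal_leading F f : ~ face_ideal F f ->
  exists m, [/\ mnm_supp m \subset F, f m != 0 &
    forall u, mnm_supp u \subset F -> (u < m)%O -> f u = 0].
Proof.
move=> /existsNP[m0 /not_implyP[m0F /eqP fm0]].
elim/(@ltmwf n): m0 m0F fm0 => m IH mF fm.
have [[u [uF um fu]]|no] := pselect (exists u,
    [/\ mnm_supp u \subset F, (u < m)%O & f u != 0]).
  exact: IH fu.
exists m; split=> // u uF um; apply/eqP; apply: contra_notT no => fu.
by exists u.
Qed.

(** The product of the leading monomials of [f] and [g] supported in [F] has only
    one decomposition that contributes to [f * g], so it survives. *)
Lemma face_ideal_prime F f g :
  face_ideal F (f * g) -> face_ideal F f \/ face_ideal F g.
Proof.
move=> fgF; apply: contrapT => /not_orP[/face_ideal_leading[u [uF fu umin]]].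
move=> /face_ideal_leading[v [vF gv vmin]].
have : (f * g) (u + v)%MM = f u * g v.
  apply: mpscoef_unique_factor => // u' v' uvE u'u.
  have uvF : mnm_supp u' :|: mnm_supp v' \subset F.
    by rewrite -mnm_suppD -uvE mnm_suppD finset.subUset uF.
  move: uvF; rewrite finset.subUset => /andP[u'F v'F].
  have [lt|gt|eq] := ltgtP u' u.
  - by rewrite umin // mul0r.
  - rewrite (vmin v') ?mulr0 // ltNge; apply/negP => vv'.
    have : (u + v < u' + v')%O%MM by exact: ltmc_le_add.
    by rewrite -uvE ltxx.
  - by rewrite eq eqxx in u'u.
rewrite fgF; last by rewrite mnm_suppD finset.subUset uF.
by move/esym/eqP; rewrite mulf_eq0 (negbTE fu) (negbTE gv).
Qed.

Lemma face_ideal_xset F G : face_ideal F (mps_xset k G) <-> ~~ (G \subset F).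
Proof.
rewrite mps_xsetE; split=> [GF|nGF m mF] /=.
  apply/negP => GsF; have := GF (mnm_set G).
  by rewrite mnm_supp_set /= eqxx => /(_ GsF)/eqP; rewrite oner_eq0.
by case: eqP => // mE; move: mF; rewrite mE mnm_supp_set (negbTE nGF).
Qed.

Lemma mnm_supp0 : mnm_supp 0%MM = finset.set0.
Proof. by apply/setP => i; rewrite !inE mnm0E. Qed.

Lemma face_ideal1 F : ~ face_ideal F 1.
Proof.
move=> /(_ 0%MM); rewrite mnm_supp0 finset.sub0set mpscoef1 eqxx => /(_ isT)/eqP.
by rewrite oner_eq0.
Qed.

Variable I : idealr S.
Local Notation Delta := (stanley_reisner_complex I).

Lemma xset_sub F G : F \subset G -> mps_xset k F \in I -> mps_xset k G \in I.
Proof.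
move=> FG FI; rewrite /mps_xset (bigID (mem F)) /= (eq_bigl (mem F)).
  by rewrite mulrC; apply: idealMr.
by move=> i /=; case iF: (i \in F); rewrite ?andbF // (fintype.subsetP FG).
Qed.

Lemma face_sub F G : F \subset G -> G \in Delta -> F \in Delta.
Proof. by rewrite !inE => FG; apply: contra => /(xset_sub FG). Qed.

Lemma facet_of_face F : F \in Delta -> exists2 G, G \in facets I & F \subset G.
Proof.
move=> FD; have [G Gmax FG] := @maxset_exists _ (mem Delta) F FD.
by exists G; rewrite // inE.
Qed.

Lemma facet_face F : F \in facets I -> F \in Delta.
Proof. by rewrite inE => /maxsetp. Qed.

Lemma facet_max F G : F \in facets I -> G \in Delta -> F \subset G -> G = F.
Proof. by rewrite inE => /maxsetsup; apply. Qed.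

Hypothesis Isf : is_squarefree_monomial_ideal I.

(** From right to left, [f] is split into the finitely many series collecting the
    monomials of a given support [F]; each is a multiple of [mps_xset k F], and
    this is in [I] as [F] is not a face. *)
Lemma squarefree_monomial_idealP f :
  f \in I <-> forall m, mnm_supp m \in Delta -> f m = 0.
Proof.
split=> [fI m mD|fD].
  have [G IE] := Isf.
  have : ideal_gen [set mps_xset k F | F in [set` G]]%classic f by rewrite -IE.
  move/(@ideal_gen_sub _ _ (face_ideal (mnm_supp m))); apply=> //.
    exact: is_ideal_face.
  move=> _ [F FG <-]; apply/face_ideal_xset; apply/negP => FDm.
  have : F \in Delta by apply: face_sub mD.
  rewrite inE => /negP; apply.
  have : [set` I]%classic (mps_xset k F).
    by rewrite IE; apply: mem_ideal_gen; exists F.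
  by [].
have -> : f = \sum_(F in ~: Delta)
    MPSeries (fun m => if mnm_supp m == F then f m else 0).
  apply: mpseriesP => m; rewrite mpscoef_sum /=.
  have [mD|mD] := boolP (mnm_supp m \in Delta).
    by rewrite fD // big1 // => F _; rewrite if_same.
  rewrite (bigD1 (mnm_supp m)) ?finset.in_setC //= eqxx big1 ?addr0 // => F /andP[_].
  by rewrite eq_sym => /negbTE ->.
apply: (rpred_sum (S := I)) => F; rewrite !inE negbK => FI.
rewrite [X in X \in _](@mps_monom_dvdP (mnm_set F)) /=; last first.
  by move=> m; case: (mnm_supp m =P F) => [<- _|_]; rewrite ?eqxx // mnm_set_le.
by rewrite mulrC -mps_xsetE; apply: idealMr.
Qed.

Lemma squarefree_monomial_ideal_facets f :
  f \in I <-> forall F, F \in facets I -> face_ideal F f.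
Proof.
rewrite squarefree_monomial_idealP; split=> [fD F /facet_face FD m mF|fF m mD].
  by apply: fD; apply: face_sub FD.
by have [G GI mG] := facet_of_face mD; apply: fF mG.
Qed.

End FaceIdeals.

(** * Equations of integral dependence from products *)

Section IntegralEquation.
Variables (A : comNzRingType) (J : set A).
Hypothesis idJ : is_ideal J.

Lemma ideal_powS i y z : J y -> ideal_pow J i z -> ideal_pow J i.+1 (y * z).
Proof.
move=> Jy; have [P0 PD PM] : is_ideal (ideal_pow J i.+1) := @is_ideal_gen _ _.
pose K : set A := [set z | ideal_pow J i.+1 (y * z)]%classic.
apply: (@ideal_gen_sub _ _ K) => [|_ [f Jf ->]].
  split; rewrite /K /=; first by rewrite mulr0.
    by move=> u v; rewrite mulrDr; apply: PD.
  by move=> a u; rewrite mulrCA; apply: PM.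
apply: mem_ideal_gen; exists (fun j => oapp f y (unlift ord0 j)).
  by move=> j; case: (unlift ord0 j) => //=.
rewrite big_ord_recl unlift_none; congr (_ * _).
by apply: eq_bigr => j _; rewrite liftK.
Qed.

Lemma prod_sub_expand x (s : seq A) : (forall y, y \in s -> J y) ->
  exists c : nat -> A,
    [/\ c 0%N = 1, forall i, ideal_pow J i (c i) &
      \prod_(y <- s) (x - y)
        = \sum_(0 <= i < (size s).+1) c i * x ^+ (size s - i)].
Proof.
have pow_ideal i : is_ideal (ideal_pow J i) := @is_ideal_gen _ _.
have ideal_powE0 i : ideal_pow J i 0 by case: (pow_ideal i).
(* The induction needs the coefficients to vanish beyond the size of [s]. *)
suff H : (forall y, y \in s -> J y) -> exists c : nat -> A,
    [/\ c 0%N = 1, forall i, ideal_pow J i (c i),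
        forall i, (size s < i)%N -> c i = 0 &
      \prod_(y <- s) (x - y)
        = \sum_(0 <= i < (size s).+1) c i * x ^+ (size s - i)].
  by move=> /H[c [c0 cJ _ cE]]; exists c.
elim: s => [_|y s IHs Js].
  exists (fun i => (i == 0%N)%:R); split=> //.
  - move=> [|i] /=; last exact: ideal_powE0.
    apply: mem_ideal_gen; exists (fun=> 0); last by rewrite big_ord0.
    by case: idJ.
  - by move=> [].
  - by rewrite big_nil big_nat1 eqxx mul1r subnn expr0.
have [|c [c0 cJ cs cE]] := IHs.
  by move=> z zs; apply: Js; rewrite in_cons zs orbT.
have Jy : J y by apply: Js; rewrite mem_head.
(* Multiplication by [x - y] changes the coefficients in this way. *)
exists (fun i => if i is j.+1 then c i - y * c j else 1); split=> //.
- move=> [|i] /=; first by rewrite -c0.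
  by apply: (idealB (pow_ideal _)) => //; apply: ideal_powS.
- by move=> [|i] //=; rewrite ltnS => si; rewrite !cs ?mulr0 ?subr0 // ltnW.
rewrite big_cons cE /= [RHS]big_nat_recl // mul1r subn0.
under [in RHS]eq_bigr => i _ do rewrite subSS mulrBl -mulrA.
rewrite sumrB -mulr_sumr mulrBl addrA; congr (_ - _).
have -> : x ^+ (size s).+1
      + \sum_(0 <= i < (size s).+1) c i.+1 * x ^+ (size s - i)
    = \sum_(0 <= i < (size s).+2) c i * x ^+ ((size s).+1 - i).
  by rewrite [RHS]big_nat_recl // c0 mul1r subn0.
rewrite [RHS]big_nat_recr //= cs // mul0r addr0 mulr_sumr !big_nat.
by apply: eq_bigr => i /andP[_ si]; rewrite mulrCA -exprS subSn.
Qed.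

Lemma integral_equation_prod x m (b : 'I_m -> A) :
  (forall j, J (b j)) -> \prod_(j < m) (x - b j) = 0 -> integral_equation m J x.
Proof.
move=> Jb prod0; pose s := [seq b j | j <- enum 'I_m].
have sz : size s = m by rewrite size_map size_enum_ord.
have [|c [c0 cJ]] := @prod_sub_expand x s; first by move=> _ /mapP[j _ ->].
rewrite big_map big_enum prod0 sz big_nat_recl // c0 mul1r subn0 => cE.
by exists c => //; rewrite big_add1 [RHS]cE.
Qed.

End IntegralEquation.

(** * The operator on power series *)

Section ToricOperator.
Variables (n : nat) (k : fieldType) (q : nat).
Local Notation S := (mpseries n k).
Variable Phi : S -> S.
Hypotheses (q_gt1 : (1 < q)%N) (lin : @qlinear q S Phi).
Hypothesis mpscoef_Phi : forall f m, Phi f m ^+ q = f (m *+ q)%MM.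
Implicit Types (f g c : S) (F : {set 'I_n}).

Lemma mpscoef_iter E f m : iter E Phi f m ^+ (q ^ E) = f (m *+ (q ^ E))%MM.
Proof.
elim: E m => [|E IHE] m; first by rewrite expn0 expr1 mulm1n.
rewrite iterS expnS exprM mpscoef_Phi IHE; congr (f _); apply/mnmP => i.
by rewrite !mulmnE mulnA.
Qed.

(** If [x^m] occurs in the image then [q m] is at least the indicator exponent of
    [F]; hence so is [m], as both have the same support. *)
Lemma toric_xset F f : exists g, Phi (mps_xset k F * f) = mps_xset k F * g.
Proof.
eexists; rewrite mps_xsetE; apply: mps_monom_dvdP => m PhiFm.
have : Phi (mps_monom k (mnm_set F) * f) m ^+ q != 0 by rewrite expf_neq0.
rewrite mpscoef_Phi mpscoef_monomM; case: ifP => [Fm _|]; last by rewrite eqxx.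
move: Fm; rewrite !mnm_set_le => /fintype.subset_trans; apply.
by apply/fintype.subsetP => i; rewrite !inE mulmnE muln_eq0 negb_or => /andP[].
Qed.

Lemma iter_toric_xset E F f :
  exists g, iter E Phi (mps_xset k F * f) = mps_xset k F * g.
Proof.
elim: E => [|E [g IHE]]; first by exists f.
by rewrite iterS IHE; apply: toric_xset.
Qed.

(** A monomial [m] of [c] supported in [F] is moved by multiplication to the
    [Q]-th power of [x_F], where [Q = q ^ E] exceeds all exponents of [m].
    The multiplication adds [Q - m_i > 0] to the exponents in [F], so every
    monomial of the image is a multiple of [x_F], and [x_F] itself occurs.  Thus
    the image is [x_F] times a unit, which is absorbed into the multiplier. *)
Lemma toric_recovers_xset F c : ~ face_ideal F c ->
  exists E0, forall E, (E0 <= E)%N ->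
    exists d, iter E Phi (mps_xset k F * (d * c)) = mps_xset k F.
Proof.
move=> /existsNP[m /not_implyP[mF /eqP cm]]; exists (mdeg m) => E mE.
set Q := (q ^ E)%N.
have mQ i : (m i < Q)%N.
  apply: leq_ltn_trans (leq_ltn_trans mE (ltn_expl _ q_gt1)).
  by rewrite mdegE (bigD1 i) //= leq_addr.
have m0 i : i \notin F -> m i = 0%N.
  move=> iF; apply/eqP; apply: contraNT iF => mi.
  by apply: (fintype.subsetP mF); rewrite inE.
(* The exponent [Q] on [F], less [m] and less the factor [x_F]. *)
pose w : 'X_{1..n} := [multinom ((i \in F) * (Q - (m i).+1))%N | i < n].
pose h := iter E Phi (mps_xset k F * (mps_monom k w * c)).
have shiftE : (mnm_set F + w + m = mnm_set F *+ Q)%MM.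
  apply/mnmP => i; rewrite !mnmDE mulmnE !mnmE.
  have := mQ i; case: (boolP (i \in F)) => [_ miQ|iF _].
    by rewrite !mul1n add1n addSnnS subnK.
  by rewrite m0.
have hE u : h u ^+ Q
    = if (mnm_set F + w <= u *+ Q)%MM
      then c (u *+ Q - (mnm_set F + w))%MM else 0.
  by rewrite /h mpscoef_iter mulrA mps_xsetE -mps_monomD mpscoef_monomM.
have hdvd u : h u != 0 -> (mnm_set F <= u)%MM.
  move=> hu; have : h u ^+ Q != 0 by rewrite expf_neq0.
  rewrite hE; case: ifP => [le _|_]; last by rewrite eqxx.
  apply/mnm_lepP => i; move/mnm_lepP/(_ i): le.
  rewrite mnmDE mulmnE !mnmE; case: (i \in F) => //=.
  by rewrite lt0n; apply: contraTneq => ->; rewrite mul0n.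
have hF : h = mps_xset k F * MPSeries (fun u => h (mnm_set F + u)%MM).
  by rewrite mps_xsetE; apply: mps_monom_dvdP.
have [|v vE] := @mps_unit _ _ (MPSeries (fun u => h (mnm_set F + u)%MM)).
  rewrite /= addm0; apply: contraNneq cm => h0.
  have := hE (mnm_set F); rewrite h0 -shiftE lem_addr addmC addmK => <-.
  by rewrite expr0n expn_eq0 gtn_eqF // ltnW.
(* The inverse [v] of the unit enters the operator as [v ^+ Q]. *)
exists (v ^+ Q * mps_monom k w).
by rewrite -mulrA mulrCA (iter_qlinearM lin) -/h hF mulrCA [v * _]mulrC vE mulr1.
Qed.

End ToricOperator.

(** * Minimal primes, test ideal and tight closure in the quotient *)

Section ToricQuotient.
Variables (n : nat) (k : fieldType) (q : nat).
Local Notation S := (mpseries n k).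
Variable I : idealr S.
Local Notation R := {ideal_quot I}.
Hypothesis Isf : is_squarefree_monomial_ideal I.
Implicit Types (f g c : S) (F G : {set 'I_n}) (r x : R).

Local Open Scope quotient_scope.

Lemma pi0 : \pi_R 0 = 0. Proof. exact: rmorph0. Qed.
Lemma pi1 : \pi_R 1 = 1. Proof. exact: rmorph1. Qed.
Lemma piD f g : \pi_R (f + g) = \pi_R f + \pi_R g. Proof. exact: rmorphD. Qed.
Lemma piB f g : \pi_R (f - g) = \pi_R f - \pi_R g. Proof. exact: rmorphB. Qed.
Lemma piM f g : \pi_R (f * g) = \pi_R f * \pi_R g. Proof. exact: rmorphM. Qed.
Lemma piX f i : \pi_R (f ^+ i) = \pi_R f ^+ i. Proof. exact: rmorphXn. Qed.

Lemma pi_eq0 f : (\pi_R f = 0) <-> f \in I.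
Proof.
rewrite -pi0 -[X in _ <-> X \in _](subr0 f) Quotient.idealrBE.
by split=> [->//|/eqP].
Qed.

(** The image of [face_ideal F], tested on a representative; this is independent
    of the representative when [I] is contained in [face_ideal F]. *)
Definition face_prime F : set R := [set r | face_ideal F (repr r)]%classic.

Lemma face_prime_pi F f :
  F \in facets I -> face_prime F (\pi_R f) <-> face_ideal F f.
Proof.
move=> FI; have idF := is_ideal_face k F.
have dF : face_ideal F (repr (\pi_R f) - f).
   have /(squarefree_monomial_ideal_facets Isf) : repr (\pi_R f) - f \in I.
    by apply/pi_eq0; rewrite piB reprK subrr.
  by apply.
split=> h; last first.
  by rewrite /face_prime /= -[repr _](subrK f); case: idF => _ D _; apply: D.
by rewrite -[f](subKr (repr (\pi_R f))); apply: (idealB idF).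
Qed.

Lemma facet_primes_cap0 r :
  (forall F, F \in facets I -> face_prime F r) -> r = 0.
Proof.
rewrite -[r]reprK => rF.
apply/pi_eq0/(squarefree_monomial_ideal_facets Isf) => F FI.
by apply/face_prime_pi/rF.
Qed.

Lemma is_prime_face F : F \in facets I -> is_prime_ideal (face_prime F).
Proof.
move=> FI; have [i0 iD iM] := is_ideal_face k F.
split=> [||r r'].
- split=> [|r r'|r r'].
  + by rewrite -pi0; apply/face_prime_pi.
  + by rewrite -[r]reprK -[r']reprK -piD !face_prime_pi //; apply: iD.
  + by rewrite -[r]reprK -[r']reprK -piM !face_prime_pi //; apply: iM.
- by rewrite -pi1 face_prime_pi //; apply: face_ideal1.
by rewrite -[r]reprK -[r']reprK -piM !face_prime_pi //; apply: face_ideal_prime.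
Qed.

(** Otherwise choose in each facet prime an element outside [P]: the product of
    these elements is in all facet primes, so it is [0], and yet it is outside
    the prime [P]. *)
Lemma prime_contains_face P : is_prime_ideal P ->
  exists2 F, F \in facets I & (face_prime F `<=` P)%classic.
Proof.
move=> Pp; apply: contrapT => noF.
have out F : exists r, F \in facets I -> face_prime F r /\ ~ P r.
  have [FI|nFI] := boolP (F \in facets I); last by exists 0.
  apply: contrapT => no; apply: noF; exists F => // r Fr.
  by apply: contrapT => Pr; apply: no; exists r.
pose w F := sval (cid (out F)).
have wP F : F \in facets I -> face_prime F (w F) /\ ~ P (w F)
  := svalP (cid (out F)).
apply: (@prime_ideal_prod _ P _ (index_enum _) (mem (facets I)) w Pp).
  by move=> F /wP[].
rewrite (facet_primes_cap0 (r := \prod_(F in facets I) w F)).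
  by case: Pp => [[]].
move=> F FI; rewrite (bigD1 F) //= mulrC.
by have [[_ _ M] _ _] := is_prime_face FI; apply/M/(wP F FI).1.
Qed.

Lemma face_prime_sub F G : F \in facets I -> G \in facets I ->
  (face_prime F `<=` face_prime G)%classic -> F = G.
Proof.
move=> FI GI FG.
suff GF : G \subset F by exact: (facet_max GI (facet_face FI) GF).
apply: contrapT => /negP GF.
have : face_prime F (\pi_R (mps_xset k G)).
  by apply/face_prime_pi => //; apply/face_ideal_xset.
by move/FG; rewrite face_prime_pi // face_ideal_xset fintype.subxx.
Qed.

Lemma minimal_prime_facetP P :
  is_minimal_prime P <-> exists2 F, F \in facets I & P = face_prime F.
Proof.
split=> [[Pp Pmin]|[F FI ->]].
  have [F FI FP] := prime_contains_face Pp.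
  by exists F => //; rewrite (Pmin _ (is_prime_face FI) FP).
split=> [|P' P'p P'F]; first exact: is_prime_face.
have [G GI GP'] := prime_contains_face P'p.
have GF : G = F by apply: face_prime_sub => //; apply: subset_trans P'F.
by apply/seteqP; split=> //; rewrite -GF.
Qed.

Lemma not_in_minimal_primesP r :
  not_in_minimal_primes R r <-> forall F, F \in facets I -> ~ face_prime F r.
Proof.
split=> [nr F FI Fr|nr [P /minimal_prime_facetP[F FI ->]]]; last exact: nr.
by apply: nr; exists (face_prime F) => //; apply/minimal_prime_facetP; exists F.
Qed.

Definition facet_monomial F : R := \pi_R (mps_xset k F).

Lemma facet_monomial_prime F G : F \in facets I -> G \in facets I ->
  face_prime F (facet_monomial G) <-> G != F.
Proof.
move=> FI GI; rewrite face_prime_pi // face_ideal_xset; split=> [|GF].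
  by apply: contra => /eqP ->.
apply: contra GF => GF; apply/eqP/esym; exact: (facet_max GI (facet_face FI) GF).
Qed.

Lemma facet_monomial_ann F r : F \in facets I ->
  facet_monomial F * r = 0 -> face_prime F r.
Proof.
move=> FI Fr; have [_ _ pr] := is_prime_face FI.
case: (pr (facet_monomial F) r) => //.
  by rewrite Fr; have [[]] := is_prime_face FI.
by rewrite facet_monomial_prime // eqxx.
Qed.

Variables (Phi : S -> S) (phi : R -> R).
Hypotheses (q_gt1 : (1 < q)%N) (lin : @qlinear q S Phi).
Hypothesis mpscoef_Phi : forall f m, Phi f m ^+ q = f (m *+ q)%MM.
Hypothesis phi_pi : forall f, phi (\pi_R f) = \pi_R (Phi f).

Lemma quotient_qlinear : @qlinear q R phi.
Proof.
move=> a t u; rewrite /qincl /qroot -[a]reprK -[t]reprK -[u]reprK.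
rewrite -[_ * _ + _](_ : \pi_R (repr a ^+ q * repr t + repr u) = _).
  by rewrite !phi_pi lin piD piM.
by rewrite piD piM piX.
Qed.

Lemma iter_phi_pi E f : iter E phi (\pi_R f) = \pi_R (iter E Phi f).
Proof. by elim: E => // E IHE; rewrite !iterS IHE phi_pi. Qed.

Lemma phi_facet_monomial E F r :
  exists s, iter E phi (facet_monomial F * r) = facet_monomial F * s.
Proof.
have [g gE] := iter_toric_xset mpscoef_Phi E F (repr r).
by exists (\pi_R g); rewrite -piM -gE -iter_phi_pi piM reprK.
Qed.

Lemma phi_recovers_facet_monomial F r : F \in facets I -> ~ face_prime F r ->
  exists E0, forall E, (E0 <= E)%N ->
    exists d, iter E phi (facet_monomial F * (d * r)) = facet_monomial F.
Proof.
rewrite -[r]reprK => FI; rewrite face_prime_pi // => rF.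
have [E0 E0P] := toric_recovers_xset q_gt1 lin mpscoef_Phi rF.
exists E0 => E /E0P[d dE]; exists (\pi_R d).
by rewrite -!piM iter_phi_pi dE.
Qed.

Definition facet_ideal : set R :=
  ideal_gen (range (fun j : 'I_(f_max I) => facet_monomial (enum_val j))).

Lemma facet_idealP F : F \in facets I -> facet_ideal (facet_monomial F).
Proof.
move=> FI; apply: mem_ideal_gen; exists (enum_rank_in FI F) => //.
by rewrite enum_rankK_in.
Qed.

Lemma facet_ideal_compatible : @phi_compatible q R phi facet_ideal.
Proof.
pose K : set R := [set r | forall s, facet_ideal (phi (r * s))]%classic.
have philin := quotient_qlinear.
have [T0 TD TM] : is_ideal facet_ideal := @is_ideal_gen _ _.
have sub : (facet_ideal `<=` K)%classic.
  apply: ideal_gen_sub => [|_ [j _ <-] s].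
    split=> [s|x y Kx Ky s|a x Kx s].
    - by rewrite mul0r (qlinear0 philin).
    - by rewrite mulrDl (qlinearD philin); apply: TD.
    - by rewrite mulrAC mulrC; apply: Kx.
  have [g] := phi_facet_monomial 1 (enum_val j) s; rewrite /= => ->.
  by rewrite mulrC; apply: TM; apply: facet_idealP; exact: enum_valP.
move=> _ [_ [r Tr <-] <-]; have := sub r Tr 1; by rewrite mulr1.
Qed.

(** The witness is the sum of all [x_F]: modulo the prime of [F] it is [x_F],
    because every other facet has a vertex outside [F]. *)
Lemma facet_ideal_not_in_minimal_primes :
  (facet_ideal `&` not_in_minimal_primes R !=set0)%classic.
Proof.
exists (\sum_(F in facets I) facet_monomial F); split.
  by apply: ideal_sum; [exact: is_ideal_gen | exact: facet_idealP].
apply/not_in_minimal_primesP => F FI; rewrite (bigD1 F) //= => sumF.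
have [idF _ _] := is_prime_face FI.
suff : face_prime F (facet_monomial F) by rewrite facet_monomial_prime // eqxx.
rewrite -[facet_monomial F](addrK (\sum_(G in facets I | G != F) facet_monomial G)).
apply: (idealB idF) => //; apply: ideal_sum => // G /andP[GI GF].
exact/facet_monomial_prime.
Qed.

(** For [c] in [J] outside the minimal primes, [x_F] is the image of a multiple
    of [c] under an iterate of [phi], and [J] is stable under [phi]. *)
Lemma facet_ideal_min J : is_ideal J -> @phi_compatible q R phi J ->
  (J `&` not_in_minimal_primes R !=set0)%classic -> (facet_ideal `<=` J)%classic.
Proof.
move=> idJ compJ [c [Jc /not_in_minimal_primesP cF]].
have iterJ E r : J r -> J (iter E phi r).
  move=> Jr; elim: E => // E IHE; apply: compJ.
  by exists (iter E phi r) => //; exists (iter E phi r).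
apply: (ideal_gen_sub idJ) => _ [j _ <-]; set F := enum_val j.
have FI : F \in facets I by exact: enum_valP.
have [E0 /(_ _ (leqnn E0))[d <-]] := phi_recovers_facet_monomial FI (cF F FI).
by apply: iterJ; apply: (idealMl _ idJ); apply: (idealMl _ idJ Jc).
Qed.

Lemma facet_ideal_is_test_ideal : @is_test_ideal q R phi facet_ideal.
Proof.
split=> [|J []]; last exact: facet_ideal_min.
split; [exact: is_ideal_gen | exact: facet_ideal_compatible |].
exact: facet_ideal_not_in_minimal_primes.
Qed.

(** Write [x_F = phi^E (x_F d c)] and move [x] inside as [x ^+ (q ^ E)].
    The elements [z] all of whose multiples [x_F r z] are mapped by [phi^E] into
    [x_F a] form an ideal [K], which contains the generators of the Frobenius
    power of [a], and hence [c * x ^+ (q ^ E)]. *)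
Lemma facet_monomial_tight_closure p e (a : set R) x F :
    (0 < e)%N -> q = (p ^ e)%N -> is_ideal a -> tight_closure p a x ->
    F \in facets I ->
  exists2 b, a b & facet_monomial F * (x - b) = 0.
Proof.
move=> e_gt0 qE [a0 aD aM] [c /not_in_minimal_primesP cF [N xN]] FI.
have [E0 E0P] := phi_recovers_facet_monomial FI (cF F FI).
have [d dE] := E0P _ (leq_maxl E0 N).
set E := maxn E0 N in dE.
have qEE : (q ^ E = p ^ (e * E))%N by rewrite qE expnM.
have philin := quotient_qlinear.
pose K : set R := [set z | forall r, exists2 b, a b &
  iter E phi (facet_monomial F * (r * z)) = facet_monomial F * b]%classic.
have idK : is_ideal K.
  split=> [r|y z Ky Kz r|s z Kz r].
  - by exists 0 => //; rewrite !mulr0 (iter_qlinear0 philin).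
  - have [b ab bE] := Ky r; have [b' ab' b'E] := Kz r.
    exists (b + b'); first exact: aD ab ab'.
    by rewrite !mulrDr (iter_qlinearD philin) bE b'E.
  - by have [b ab bE] := Kz (r * s); exists b; rewrite // [r * _]mulrA.
have : frobenius_pow a (p ^ (e * E)) (c * x ^+ (p ^ (e * E))).
  by apply: xN; apply: leq_trans (leq_maxr E0 N) _; apply: leq_pmull.
have genK : ([set y ^+ (p ^ (e * E)) | y in a] `<=` K)%classic.
  move=> _ [y ay <-] r.
  have [s sE] := phi_facet_monomial E F r.
  exists (s * y); first exact: aM.
  by rewrite -qEE [r * _]mulrC mulrCA (iter_qlinearM philin) sE mulrCA [y * _]mulrC.
move=> /(ideal_gen_sub idK genK)/(_ d)[b ab bE]; exists b => //.
rewrite mulrBr -bE -{1}dE.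
rewrite -qEE mulrC -(iter_qlinearM philin); apply/eqP; rewrite subr_eq0; apply/eqP.
congr (iter E phi _).
by rewrite mulrCA; congr (_ * _); rewrite mulrCA [_ * c]mulrC.
Qed.

End ToricQuotient.

Theorem corollary3p11 (k : fieldType) (p : nat) (hk : perfect_of_char p k)
    (n e q : nat) (he : (1 <= e)%N) (hq : q = (p ^ e)%N)
    (I : idealr (mpseries n k)) (hI : is_squarefree_monomial_ideal I)
    (PhiS : qroots q (mpseries n k) -> mpseries n k) (hPhiS : is_trace_map PhiS)
    (phi : qroots q {ideal_quot I} -> {ideal_quot I})
    (hphi : is_induced_map
      (fun s => PhiS (qroot q ((\prod_(i < n) mps_var k i) ^+ (q - 1)) * s)) phi) :
  (exists tau : set {ideal_quot I},
     is_test_ideal phi tau /\ generated_by_n (f_max I) tau) /\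
  (forall (a : set {ideal_quot I}) (x : {ideal_quot I}),
     is_ideal a -> tight_closure p a x -> integral_equation (f_max I) a x).
Proof.
have q_gt1 : (1 < q)%N.
  by rewrite hq -(exp1n e) ltn_exp2r // prime_gt1 // (pcharf_prime hk.1).
pose Phi (s : mpseries n k) : mpseries n k :=
  PhiS (qroot q ((\prod_(i < n) mps_var k i) ^+ (q - 1)) * s).
have lin : @qlinear q _ Phi by apply: qlinear_premul; case: hPhiS.
have coefPhi f m : Phi f m ^+ q = f (m *+ q)%MM by apply: (mpscoef_toric_trace hk hq).
have phi_pi f : phi (\pi_({ideal_quot I})%qT f) = \pi_({ideal_quot I})%qT (Phi f).
  exact: hphi.2.
split=> [|a x ida xa].
  exists (@facet_ideal n k I); split; last by eexists.
  exact: (facet_ideal_is_test_ideal hI q_gt1 lin coefPhi phi_pi).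
have bP F : exists b, F \in facets I -> a b /\ @facet_monomial n k I F * (x - b) = 0.
  have [FI|nFI] := boolP (F \in facets I); last by exists 0.
  have [b ab bE] := facet_monomial_tight_closure hI q_gt1 lin coefPhi phi_pi
                      he hq ida xa FI.
  by exists b.
pose b F := sval (cid (bP F)).
have bE F : F \in facets I -> a (b F) /\ @facet_monomial n k I F * (x - b F) = 0
  := svalP (cid (bP F)).
apply: (@integral_equation_prod _ _ ida _ _ (fun j => b (enum_val j))) => [j|].
  exact: (bE _ (enum_valP j)).1.
(* The product of the [x - b F] vanishes: it lies in every minimal prime. *)
apply: (facet_primes_cap0 hI) => F FI.
rewrite (bigD1 (enum_rank_in FI F)) //= enum_rankK_in // mulrC.
have [[_ _ M] _ _] := is_prime_face hI FI.
by apply: M; apply: (facet_monomial_ann hI FI); case: (bE F FI).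
Qed.
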